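(* Let $k \ge 2$ be an integer. There exist constants $c_1 = c_1(k)$ and $c_2 = c_2(k)$ such that for every integer $n \ge 2\cdot 3^k$, $$\frac{nk}{2} - c_1 \le \mathrm{sis}(n, K_{1,k+1}) \le nk + c_2.$$
   Context: All graphs are finite and simple. For a graph $H$, a graph $G$ is $H$-induced-saturated if $G$ contains no induced subgraph isomorphic to $H$, but for every pair of distinct vertices $u,v$ of $G$, the graph obtained from $G$ by adding the edge $uv$ (if $uv\notin E(G)$) or deleting it (if $uv\in E(G)$) contains an induced subgraph isomorphic to $H$. When an $n$-vertex $H$-induced-saturated graph exists, $\mathrm{sis}(n,H)$ denotes the minimum number of edges in an $n$-vertex $H$-induced-saturated graph. (For $k\ge 2$ and $n \ge 3^k$ such graphs exist for $H=K_{1,k+1}$.) *)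

(* Defs.v *)
From mathcomp Require Import all_boot.
Set Implicit Arguments.
Unset Strict Implicit.
Unset Printing Implicit Defensive.

Record sgraph := SGraph {
  vertex :> finType;
  adj : rel vertex;
  adj_sym : symmetric adj;
  adj_irrefl : irreflexive adj }.

Definition edges (G : sgraph) : {set {set G}} :=
  [set [set p.1; p.2] | p : G * G & adj p.1 p.2].

Section InducedSubgraph.
Variables (G : sgraph) (S : {set G}).

Definition induced_adj : rel {x : G | x \in S} :=
  fun x y => adj (val x) (val y).

Lemma induced_adj_sym : symmetric induced_adj.
Proof. by move=> x y; exact: adj_sym. Qed.

Lemma induced_adj_irrefl : irreflexive induced_adj.
Proof. by move=> x; exact: adj_irrefl. Qed.

Definition induced : sgraph := SGraph induced_adj_sym induced_adj_irrefl.

End InducedSubgraph.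

Definition isomorphic (G H : sgraph) : Prop :=
  exists2 f : G -> H, bijective f & forall x y, adj (f x) (f y) = adj x y.

Definition contains_induced (G H : sgraph) : Prop :=
  exists S : {set G}, isomorphic (induced S) H.

(* [toggle uv] adds the edge uv to G if it is absent and deletes it if it is
   present. *)
Section Toggle.
Variables (G : sgraph) (u v : G).

Definition toggle_adj : rel G :=
  fun x y => if [set x; y] == [set u; v] then ~~ adj x y else adj x y.

Lemma toggle_adj_sym : symmetric toggle_adj.
Proof. by move=> x y; rewrite /toggle_adj setUC adj_sym. Qed.

Hypothesis uv : u != v.

Lemma toggle_adj_irrefl : irreflexive toggle_adj.
Proof.
move=> x; rewrite /toggle_adj adj_irrefl setUid; case: eqP => // Euv.
by have := cards2 u v; rewrite -Euv cards1 uv.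
Qed.

Definition toggle : sgraph := SGraph toggle_adj_sym toggle_adj_irrefl.

End Toggle.

Definition induced_saturated (H G : sgraph) : Prop :=
  ~ contains_induced G H /\
  forall (u v : G) (uv : u != v), contains_induced (toggle uv) H.

(* sis(n, H) is undefined when no n-vertex H-induced-saturated graph exists,
   hence a relation: [is_sis n H m] says that sis(n, H) is defined and equals
   m. *)
Definition is_sis (n : nat) (H : sgraph) (m : nat) : Prop :=
  (exists G : sgraph,
     [/\ #|G| = n, induced_saturated H G & #|edges G| = m]) /\
  (forall G : sgraph, #|G| = n -> induced_saturated H G -> m <= #|edges G|).

Section CompleteBipartite.
Variables a b : nat.

Definition biclique_adj : rel ('I_a + 'I_b)%type := fun x y =>
  match x, y with
  | inl _, inr _ | inr _, inl _ => true
  | _, _ => false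
  end.

Lemma biclique_adj_sym : symmetric biclique_adj.
Proof. by case=> i [] j. Qed.

Lemma biclique_adj_irrefl : irreflexive biclique_adj.
Proof. by case. Qed.

Definition biclique : sgraph := SGraph biclique_adj_sym biclique_adj_irrefl.

End CompleteBipartite.

(* Main.v *)
Require Import Defs.
From mathcomp Require Import all_boot all_order all_algebra.
From mathcomp Require Import zify.
From Stdlib Require Import Classical_Prop.
Import Order.TTheory GRing.Theory Num.Theory.
Local Open Scope ring_scope.

Set Implicit Arguments.
Unset Strict Implicit.

(** Lower bound: adding a non-edge uv must create a star centred at u or v, so
    one of u, v has degree at least k.  Hence the vertices of degree less than
    k form a clique, which has at most k vertices.

    Upper bound: in the Hamming graph on {0,1,2}^k every neighbourhood is a
    disjoint union of k edges, one for each direction, hence contains no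
    independent set of size k+1.  Deleting an edge uv frees a pair in the
    neighbourhood of the third point of the line through u and v; adding a
    non-edge uv gives u the independent neighbour v besides one neighbour,
    chosen away from v, in each direction.  This survives disjoint unions and
    the replacement of vertices by cliques of twins, which realizes every
    number of vertices: all but boundedly many vertices have degree 2k. *)

(** * Induced stars and edge toggling *)

Lemma ex_least (P : nat -> Prop) (n : nat) :
  P n -> exists2 m, P m & forall j, P j -> (m <= j)%N.
Proof.
elim/ltn_ind: n => n IHn Pn.
(* Classical case analysis, since [P] need not be decidable; it will be an existence statement over
   all graphs. *)
have [[m ltmn Pm]|least] := classic (exists2 m, (m < n)%N & P m).
  exact: IHn ltmn Pm.
exists n => // j Pj; rewrite leqNgt; apply/negP => ltjn.
by apply: least; exists j.
Qed.

Lemma eq_set2 (T : finType) (x y u v : T) :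
  ([set x; y] == [set u; v]) = (x == u) && (y == v) || (x == v) && (y == u).
Proof.
apply/eqP/orP => [E|[] /andP[/eqP-> /eqP->] //]; last exact: setUC.
have /set2P xuv : x \in [set u; v] by rewrite -E set21.
have /set2P yuv : y \in [set u; v] by rewrite -E set22.
have /set2P uxy : u \in [set x; y] by rewrite E set21.
have /set2P vxy : v \in [set x; y] by rewrite E set22.
case: xuv uxy vxy => -> uxy vxy; rewrite !eqxx /=; [left|right];
  by apply/eqP; intuition congruence.
Qed.

Lemma toggle_adjE (G : sgraph) (u v x y : G) :
  toggle_adj u v x y =
  adj x y (+) ((x == u) && (y == v) || (x == v) && (y == u)).
Proof. by rewrite /toggle_adj eq_set2; case: ifP; rewrite ?addbT ?addbF. Qed.

Lemma contains_inducedP (G H : sgraph) :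
  contains_induced G H <->
  exists2 f : H -> G, injective f & forall x y, adj (f x) (f y) = adj x y.
Proof.
split=> [[S [f [g fK gK] f_adj]]|[f f_inj f_adj]].
  exists (val \o g) => [|x y]; first exact: inj_comp val_inj (can_inj gK).
  by rewrite -[in RHS](gK x) -[in RHS](gK y) f_adj.
pose S := [set f x | x : H].
have fS x : f x \in S by exact: imset_f.
pose g x : induced S := exist _ (f x) (fS x).
have g_inj : injective g by move=> x y [/f_inj].
have [h gK hK] : bijective g.
  by apply: inj_card_bij => //; rewrite card_sig card_imset.
exists S; exists h => [|x y]; first by exists g.
by rewrite -[in RHS](hK x) -[in RHS](hK y) -f_adj.
Qed.

Lemma contains_starP (G : sgraph) (m : nat) :
  contains_induced G (biclique 1 m) <->
  exists c : G, exists2 f : 'I_m -> G, injective f &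
    (forall i, adj c (f i)) /\ (forall i j, ~~ adj (f i) (f j)).
Proof.
rewrite contains_inducedP; split=> [[f f_inj f_adj]|[c [f f_inj [f_c f_ind]]]].
  exists (f (inl ord0)), (f \o inr); first by move=> i j /f_inj[].
  by split=> [i|i j]; rewrite f_adj.
exists (fun x : biclique 1 m => match x with inl _ => c | inr i => f i end).
  have fc i : f i <> c by move=> E; have := f_c i; rewrite E adj_irrefl.
  case=> [i|i] [j|j] //=; first by rewrite (ord1 i) (ord1 j).
  - by move/esym/fc.
  - by move/fc.
  - by move/f_inj->.
case=> [i|i] [j|j] //=; rewrite ?adj_irrefl ?f_c 1?adj_sym ?f_c //.
exact/negbTE.
Qed.

(** Allows any index type of size [m]: the stars built below have leaves indexed by [option 'I_k],
    one per direction and an extra one. *)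
Lemma contains_star (G : sgraph) (I : finType) (m : nat) c (f : I -> G) :
    #|I| = m -> (forall i, adj c (f i)) ->
    (forall i j, i != j -> (f i != f j) && ~~ adj (f i) (f j)) ->
  contains_induced G (biclique 1 m).
Proof.
move=> <- f_c f_ind; apply/contains_starP.
have f_inj : injective f.
  by move=> i j /eqP E; apply: contraTeq E => /f_ind/andP[].
exists c, (f \o enum_val) => [|]; first exact: inj_comp f_inj enum_val_inj.
split=> [i|i j] /=; first exact: f_c.
have [->|/f_ind/andP[]//] := eqVneq (enum_val i) (enum_val j).
by rewrite adj_irrefl.
Qed.

(** * Degree sum *)

Definition degree (G : sgraph) (x : G) : nat := #|[set y | adj x y]|.

(** Double counting of ordered adjacent pairs: grouped by first component they give the degrees,
    grouped by underlying edge they come in twos. *)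
Lemma handshake (G : sgraph) : (\sum_(x : G) degree x = 2 * #|edges G|)%N.
Proof.
pose D := [set p : G * G | adj p.1 p.2].
have -> : (\sum_(x : G) degree x = #|D|)%N.
  rewrite -sum1dep_card -(pair_big_dep xpredT (fun x y => adj x y) (fun _ _ => 1%N)).
  by apply: eq_bigr => x _; rewrite sum1dep_card.
rewrite -sum1_card (partition_big_imset (fun p => [set p.1; p.2])) /=.
have -> : [set [set p.1; p.2] | p in D] = edges G.
  by apply: eq_imset => // p; rewrite inE.
rewrite mulnC -sum_nat_const; apply: eq_bigr => e /imsetP[[u v] /=].
rewrite inE /= => uv ->; rewrite sum1dep_card.
have neq_uv : u != v by apply: contraTneq uv => ->; rewrite adj_irrefl.
suff -> : [set p in D | [set p.1; p.2] == [set u; v]] = [set (u, v); (v, u)].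
  by rewrite cards2 xpair_eqE (negbTE neq_uv).
apply/setP=> [[x y]]; rewrite !inE /= eq_set2 !xpair_eqE.
apply: andb_idl => /orP[] /andP[/eqP-> /eqP->] //.
by rewrite adj_sym.
Qed.

(** * Lower bound on the number of edges *)

Section LowerBound.
Variables (G : sgraph) (k : nat).
Hypothesis G_sat : induced_saturated (biclique 1 k.+1) G.

(** If [uv] were a non-edge, a star of the toggled graph centred off [u] and [v] would already be
    induced in [G]. So the centre is [u] or [v], and at most one of its leaves is not a neighbour in
    [G]. *)
Lemma low_degree_adj (u v : G) :
  u != v -> (degree u < k)%N -> (degree v < k)%N -> adj u v.
Proof.
case: G_sat => G_free G_tog uv du dv; apply/negPn/negP => nuv.
have [c [f f_inj [f_c f_ind]]] : exists c : G,
    exists2 f : 'I_k.+1 -> G, injective f &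
      (forall i, toggle_adj u v c (f i)) /\
      (forall i j, ~~ toggle_adj u v (f i) (f j)).
  exact/(contains_starP (toggle uv))/G_tog.
have toggleW x y : adj x y -> toggle_adj u v x y.
  rewrite toggle_adjE => xy; rewrite xy addTb.
  apply/negP => /orP[] /andP[/eqP Ex /eqP Ey]; move: nuv xy; rewrite Ex Ey.
    by move/negbTE->.
  by rewrite adj_sym => /negbTE->.
(* Of the [k.+1] leaves, at least [k] differ from [w], the only leaf that may owe its edge to the
   toggle. *)
have deg_c (w : G) :
    (forall x, toggle_adj u v c x -> x != w -> adj c x) -> (k <= degree c)%N.
  move=> c_w; pose A := [set f i | i in 'I_k.+1].
  have cardA : #|A| = k.+1 by rewrite card_imset // card_ord.
  have A_c : A :\ w \subset [set y | adj c y].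
    apply/subsetP=> x /setD1P[xw /imsetP[i _ Ex]]; rewrite inE.
    by apply: c_w => //; rewrite Ex; exact: f_c.
  apply: leq_trans (subset_leq_card A_c).
  by have := cardsD1 w A; rewrite cardA; case: (_ \in _); lia.
have [cu|cu] := eqVneq c u.
  suff: (k <= degree c)%N by rewrite cu leqNgt du.
  apply: (deg_c v) => x; rewrite toggle_adjE => + /negbTE xv.
  by rewrite xv cu (negbTE uv) andbF /= addbF.
have [cv|cv] := eqVneq c v.
  suff: (k <= degree c)%N by rewrite cv leqNgt dv.
  apply: (deg_c u) => x; rewrite toggle_adjE => + /negbTE xu.
  by rewrite xu andbF orbF (negbTE cu) /= addbF.
apply/G_free/contains_starP; exists c, f => //; split=> [i|i j].
  by have := f_c i; rewrite /= toggle_adjE (negbTE cu) (negbTE cv) addbF.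
by apply: contra (f_ind i j); exact: toggleW.
Qed.

(** Vertices outside the clique [L] contribute at least [k] each to the degree sum; the at most [k]
    vertices of [L] account for the loss of [k * k]. *)
Lemma saturated_edges_ge : (#|G| * k <= 2 * #|edges G| + k * k)%N.
Proof.
pose L := [set x : G | (degree x < k)%N].
have cardL : (#|L| <= k)%N.
  have [->|[x xL]] := set_0Vmem L; first by rewrite cards0.
  have : (degree x < k)%N by rewrite inE in xL.
  apply: leq_trans; rewrite (cardsD1 x) xL ltnS; apply/subset_leq_card.
  apply/subsetP=> y /setD1P[yx]; rewrite !inE => dy.
  by apply: low_degree_adj => //; [rewrite eq_sym | rewrite inE in xL].
have: (\sum_(x in ~: L) k <= \sum_(x : G) degree x)%N.
  rewrite [X in (_ <= X)%N](bigID (mem (~: L))) /=.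
  apply: leq_trans (leq_addr _ _); apply: leq_sum => x.
  by rewrite !inE -leqNgt.
rewrite handshake sum_nat_const -(cardsC L).
have := leq_mul2r k #|L| k; rewrite cardL orbT; lia.
Qed.

End LowerBound.

(** * Disjoint Hamming graphs with twins *)

Section Twins.
Variables (k : nat) (T : finType) (C : eqType).
Variables (comp : T -> C) (pos : T -> {ffun 'I_k -> 'I_3}).

Definition colinear (d : 'I_k) (x y : {ffun 'I_k -> 'I_3}) : bool :=
  [forall e, (e != d) ==> (x e == y e)].

(** [comp] names the copy of the Hamming graph and [pos] the point in it. A point is colinear with
    itself in every direction, so for positive [k] distinct vertices over the same point are
    adjacent twins. *)
Definition twin_adj : rel T := fun u v =>
  [&& u != v, comp u == comp v & [exists d, colinear d (pos u) (pos v)]].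

Lemma colinearP d (x y : {ffun 'I_k -> 'I_3}) :
  reflect (forall e, e != d -> x e = y e) (colinear d x y).
Proof.
by apply: (iffP forall_inP) => xy e /xy => [/eqP|->].
Qed.

Lemma colinear_sym d : symmetric (colinear d).
Proof. by move=> x y; apply: eq_forallb => e; rewrite (eq_sym (x e)). Qed.

Lemma twin_adj_sym : symmetric twin_adj.
Proof.
move=> u v; rewrite /twin_adj eq_sym (eq_sym (comp u)); do 2 congr (_ && _).
by apply: eq_existsb => d; rewrite colinear_sym.
Qed.

Lemma twin_adj_irrefl : irreflexive twin_adj.
Proof. by move=> u; rewrite /twin_adj eqxx. Qed.

Definition twin_graph : sgraph := SGraph twin_adj_sym twin_adj_irrefl.

Lemma twin_nadj d e u v :
    d != e -> pos u d != pos v d -> pos u e != pos v e ->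
  (u != v) && ~~ twin_adj u v.
Proof.
move=> de uvd uve; apply/andP; split; first by apply: contraNneq uvd => ->.
apply/negP => /and3P[_ _ /existsP[b /colinearP uv]].
have [bd|bd] := eqVneq d b; last by rewrite uv ?eqxx in uvd.
by rewrite uv ?eqxx // -bd eq_sym in uve.
Qed.

(** Pigeonhole: two of the [k.+1] leaves lie in the same direction from the centre, hence on one
    line, hence are adjacent. *)
Lemma twin_star_free : ~ contains_induced twin_graph (biclique 1 k.+1).
Proof.
case/contains_starP=> c [f f_inj [f_c f_ind]].
have /fin_all_exists[d f_d] i : exists d, colinear d (pos c) (pos (f i)).
  by have /and3P[_ _ /existsP] := f_c i.
have /injectivePn[i [j ij Ed]] : ~~ injectiveb d.
  by apply/negP => /injectiveP/leq_card; rewrite !card_ord ltnn.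
have /negP[] := f_ind i j; apply/and3P; split.
- by apply: contra ij => /eqP/f_inj->.
- have /and3P[_ /eqP<- _] := f_c i.
  by have /and3P[_ /eqP<- _] := f_c j.
- apply/existsP; exists (d i); apply/colinearP => e ed.
  have /colinearP/(_ e ed)<- := f_d i.
  by have /colinearP-> := f_d j; rewrite -?Ed.
Qed.

Lemma ord3_third (a b : 'I_3) : exists c : 'I_3, (c != a) && (c != b).
Proof.
have [c] : exists c, c \in ~: [set a; b].
  apply/card_gt0P; have := cardsC [set a; b]; rewrite cards2 card_ord.
  by case: (a != b); lia.
by rewrite !inE negb_or; exists c.
Qed.

Hypothesis pos_onto : forall u x, exists2 v, comp v = comp u & pos v = x.

Lemma change_coordinate u d a :
  exists v, [/\ comp v = comp u, pos v d = a & colinear d (pos u) (pos v)].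
Proof.
have [v cv pv] := pos_onto u [ffun e => if e == d then a else pos u e].
exists v; split=> //; rewrite pv ?ffunE ?eqxx //.
by apply/colinearP => e /negbTE ed; rewrite ffunE ed.
Qed.

Lemma twin_adjW u v d :
    comp v = comp u -> colinear d (pos u) (pos v) -> pos v d != pos u d ->
  (u != v) && twin_adj u v.
Proof.
move=> cv uv uvd; suff uv' : u != v.
  by rewrite uv' /twin_adj uv' cv eqxx; apply/existsP; exists d.
by apply: contraNneq uvd => ->.
Qed.

Lemma twin_saturated : induced_saturated (biclique 1 k.+1) twin_graph.
Proof.
split=> [|u v uv]; first exact: twin_star_free.
have card_oI : #|{: option 'I_k}| = k.+1 by rewrite card_option card_ord.
have [/= auv|/= nuv] := boolP (adj u v).
  have /and3P[_ /eqP cuv /existsP[d duv]] := auv.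
  (* The centre [w] lies on the line through [u] and [v], off both points. If [u] and [v] are twins,
     [d] is any direction and [a] still exists. *)
  have [a /andP[au av]] := ord3_third (pos u d) (pos v d).
  have [w [cw pw uw]] := change_coordinate u d a.
  have vw : colinear d (pos v) (pos w).
    apply/colinearP => e ed.
    by rewrite -(colinearP _ _ _ duv e ed) (colinearP _ _ _ uw e ed).
  have /fin_all_exists[l l_w] e : exists l : T,
      [/\ comp l = comp w, pos l e != pos w e & colinear e (pos w) (pos l)].
    have [b /andP[b1 _]] := ord3_third (pos w e) (pos w e).
    have [l [cl pl wl]] := change_coordinate w e b.
    by exists l; rewrite pl.
  have l_d e : e != d -> pos (l e) d = pos w d.
    by have [_ _ /colinearP wl] := l_w e; rewrite eq_sym => /wl.
  (* Once [uv] is deleted, [u] serves as the leaf of direction [d] and [v] as the extra leaf. *)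
  pose f (i : option 'I_k) : T :=
    if i is Some e then if e == d then u else l e else v.
  have wu : (w != u) && twin_adj w u.
    apply: (@twin_adjW _ _ d) => //; last by rewrite pw eq_sym.
    by rewrite colinear_sym.
  have wv : (w != v) && twin_adj w v.
    apply: (@twin_adjW _ _ d) => //; [by rewrite cw | | by rewrite pw eq_sym].
    by rewrite colinear_sym.
  pose ind x y := (x != y) && ~~ toggle_adj (G := twin_graph) u v x y.
  have ind_sym x y : ind x y = ind y x by rewrite /ind eq_sym toggle_adj_sym.
  have uv_ind : ind u v by rewrite /ind uv toggle_adjE !eqxx /= auv.
  (* [l e] differs from [u] in coordinate [e], where [u] agrees with [w], and in coordinate [d],
     where [l e] agrees with [w]. *)
  have lu e : e != d -> (l e != u) && ~~ twin_adj (l e) u.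
    move=> ed; have [_ le _] := l_w e; apply: (twin_nadj ed).
      by rewrite (colinearP _ _ _ uw e ed).
    by rewrite l_d // pw.
  have lv e : e != d -> (l e != v) && ~~ twin_adj (l e) v.
    move=> ed; have [_ le _] := l_w e; apply: (twin_nadj ed).
      by rewrite (colinearP _ _ _ vw e ed).
    by rewrite l_d // pw.
  have lu_ind e : e != d -> ind (l e) u.
    move=> ed; have /andP[leu nleu] := lu e ed; have /andP[lev _] := lv e ed.
    by rewrite /ind leu toggle_adjE (negbTE leu) (negbTE lev) addbF.
  have lv_ind e : e != d -> ind (l e) v.
    move=> ed; have /andP[leu _] := lu e ed; have /andP[lev nlev] := lv e ed.
    by rewrite /ind lev toggle_adjE (negbTE leu) (negbTE lev) addbF.
  have ll_ind e e' : e != d -> e != e' -> ind (l e) (l e').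
    move=> ed ee'; have [_ le /colinearP wle] := l_w e.
    have [_ le' /colinearP wle'] := l_w e'.
    have /andP[leu _] := lu e ed; have /andP[lev _] := lv e ed.
    rewrite /ind toggle_adjE (negbTE leu) (negbTE lev) addbF.
    apply: (twin_nadj ee'); first by rewrite -(wle' e).
    by rewrite -(wle e') 1?eq_sym // eq_sym.
  have f_ind i j : i != j -> ind (f i) (f j).
    case: i => [e|]; case: j => [e'|] //= ij.
    - have {}ij : e != e' by [].
      have [Ee|ed] := eqVneq e d; last by case: ifP => _; [exact: lu_ind|exact: ll_ind].
      by rewrite ind_sym ifN -?Ee 1?eq_sym // lu_ind // -Ee eq_sym.
    - by case: ifPn => [_|/lv_ind].
    - by rewrite ind_sym; case: ifPn => [_|/lv_ind].
  apply: (@contains_star (toggle uv) _ _ w f card_oI) => // i /=.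
  have /andP[w_u a_wu] := wu; have /andP[w_v a_wv] := wv.
  rewrite toggle_adjE (negbTE w_u) (negbTE w_v) addbF.
  case: i => [e|] //=; case: ifP => // ed.
  have [cl le wl] := l_w e.
  by have /andP[] := twin_adjW cl wl le.
(* Non-edge case: the star is centred at [u]. Its leaf in direction [d] also avoids the coordinate
   of [v], which keeps it non-adjacent to the new leaf [v]. *)
have /fin_all_exists[l l_u] d : exists l : T,
    [/\ comp l = comp u, pos l d != pos u d, pos l d != pos v d &
        colinear d (pos u) (pos l)].
  have [a /andP[au av]] := ord3_third (pos u d) (pos v d).
  by have [l [cl pl ul]] := change_coordinate u d a; exists l; rewrite pl.
have lu d : (u != l d) && twin_adj u (l d).
  by have [cl pl _ ul] := l_u d; exact: twin_adjW cl ul pl.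
have lv d : l d != v.
  by have [_ _ plv _] := l_u d; apply: contraNneq plv => ->.
have nlv d : ~~ twin_adj (l d) v.
  have [cl _ plv /colinearP ul] := l_u d; have [cuv|cuv] := eqVneq (comp u) (comp v).
    (* In a common copy, [u] and [v] are not colinear in direction [d], so they differ in some other
       coordinate, which [l d] shares with [u]. *)
    have [e ed uve] : exists2 e, e != d & pos u e != pos v e.
      apply/exists_inP; apply: contraNT nuv; rewrite negb_exists_in => /forall_inP H.
      apply/and3P; split; rewrite ?cuv //; apply/existsP; exists d.
      by apply/colinearP => e /H /negPn/eqP.
    suff /andP[] : (l d != v) && ~~ twin_adj (l d) v by [].
    by apply: (twin_nadj ed) => //; rewrite -ul.
  by rewrite /twin_adj cl (negbTE cuv) andbF.
pose f (i : option 'I_k) : T := if i is Some d then l d else v.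
apply: (@contains_star (toggle uv) _ _ u f card_oI) => /= [i|i j].
  rewrite toggle_adjE eqxx (negbTE uv) orbF; case: i => [d|] /=.
    by have /andP[_ ->] := lu d; rewrite (negbTE (lv d)).
  by rewrite eqxx (negbTE nuv).
have lu' d : (l d == u) = false by have /andP[/negbTE + _] := lu d; rewrite eq_sym.
rewrite toggle_adjE; case: i => [d|]; case: j => [e|] //= de.
- rewrite lu' (negbTE (lv d)) addbF; have {}de : d != e by [].
  have [_ pd _ /colinearP ud] := l_u d; have [_ pe _ /colinearP ue] := l_u e.
  apply: (twin_nadj de); first by rewrite -(ue d).
  by rewrite -(ud e) 1?eq_sym // eq_sym.
- by rewrite lv lu' (negbTE (lv d)) addbF nlv.
- by rewrite eq_sym lv lu' (eq_sym v u) (negbTE uv) andbF addbF twin_adj_sym nlv.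
Qed.

End Twins.

(** * Saturated graphs of prescribed order and their edges *)

Section HammingCopies.
Variables (k q r : nat).

Let F := {ffun 'I_k -> 'I_3}.
(** The [r] vertices of the right summand become twins of the origin of copy [ord0]; [q.+1] ensures
    that this copy exists. *)
Definition copies_vertex : finType := ('I_q.+1 * F + 'I_r)%type.
Definition copies_base (t : copies_vertex) : 'I_q.+1 * F :=
  match t with inl x => x | inr _ => (ord0, [ffun=> ord0]) end.
Definition copies : sgraph :=
  twin_graph (fun t => (copies_base t).1) (fun t => (copies_base t).2).

Lemma card_copies : #|copies| = (q.+1 * 3 ^ k + r)%N.
Proof. by rewrite card_sum card_prod card_ffun !card_ord. Qed.

Lemma copies_saturated : induced_saturated (biclique 1 k.+1) copies.
Proof. by apply: twin_saturated => u x; exists (inl ((copies_base u).1, x)). Qed.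

Lemma card_first_copy :
  #|[set t : copies | (copies_base t).1 == ord0]| = (3 ^ k + r)%N.
Proof.
pose g (s : F + 'I_r) : copies := match s with
  | inl x => inl (ord0, x) | inr i => inr i end.
have g_inj : injective g by move=> [x|i] [y|j] //= [->].
rewrite -[RHS](_ : #|{: F + 'I_r}| = _)%N; last first.
  by rewrite card_sum card_ffun !card_ord.
rewrite -(card_imset _ g_inj); apply: eq_card => t; rewrite inE.
apply/eqP/imsetP => [|[[x|i] _ ->] //].
by case: t => [[c x] /= ->|i _]; [exists (inl x)|exists (inr i)].
Qed.

(** In copy [ord0] the size of the whole copy is a sufficient bound; the other copies are plain
    Hamming graphs, of degree at most [2 * k]. *)
Lemma copies_degree (t : copies) :
  (degree t <= 2 * k + ((copies_base t).1 == ord0) * (3 ^ k + r))%N.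
Proof.
have [t0|t0] := boolP (_ == ord0).
  rewrite mul1n -card_first_copy; apply: leq_trans (leq_addl _ _).
  by apply/subset_leq_card/subsetP => y; rewrite !inE => /and3P[_ /eqP<-].
rewrite mul0n addn0; case: t t0 => [[c x] /= c0|i]; last by rewrite eqxx.
(* A neighbour is given by a direction and one of the two other values there, which [lift]
   enumerates. *)
pose g (p : 'I_k * 'I_2) : copies :=
  inl (c, [ffun e => if e == p.1 then lift (x p.1) p.2 else x e]).
have <- : #|{: 'I_k * 'I_2}| = (2 * k)%N by rewrite card_prod !card_ord mulnC.
apply: leq_trans (leq_imset_card g _); apply/subset_leq_card/subsetP => y.
rewrite inE => /and3P[xy /eqP /=]; case: y xy => [[c' y]|i] /= xy Ec; last first.
  by rewrite Ec eqxx in c0.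
case/existsP=> d /colinearP /= d_xy; rewrite -{c'}Ec in xy *.
have xyd : x d != y d.
  apply: contraNneq xy => E; apply/eqP; congr (inl (_, _)); apply/ffunP => e.
  by have [->|/d_xy] := eqVneq e d.
have [b Eb] := unlift_some xyd.
move=> _; apply/imsetP; exists (d, b) => //; congr (inl (_, _)).
apply/ffunP => e; rewrite ffunE /=.
by have [->|/d_xy] := eqVneq e d.
Qed.

Lemma copies_edges :
  (2 * #|edges copies| <= 2 * k * #|copies| + (3 ^ k + r) * (3 ^ k + r))%N.
Proof.
rewrite -handshake; apply: leq_trans (leq_sum _ _) _ => [t _|].
  exact: copies_degree.
rewrite big_split /= sum_nat_const mulnC -big_distrl /= leq_add2l leq_mul2r.
by rewrite -big_mkcond sum1dep_card card_first_copy leqnn orbT.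
Qed.

End HammingCopies.

(** * The two bounds on the minimum *)

Unset Implicit Arguments.

Theorem theorem3p4 (R : realFieldType) (k : nat) (hk : (2 <= k)%N) :
  exists c1 c2 : R, forall n : nat, (2 * 3 ^ k <= n)%N ->
    exists m : nat, is_sis n (biclique 1 k.+1) m /\
      n%:R * k%:R / 2%:R - c1 <= m%:R :> R /\ m%:R <= n%:R * k%:R + c2 :> R.
Proof.
(* With [M] for [3 ^ k], the surplus [r] is below [M], so the excess [(M + r) * (M + r)] in the edge
   bound is at most the square of [2 * M]. *)
exists (k * k)%:R, ((2 * 3 ^ k) * (2 * 3 ^ k))%:R => n n_ge.
pose P m := exists G : sgraph,
  [/\ #|G| = n, induced_saturated (biclique 1 k.+1) G & #|edges G| = m].
have pow_gt0 : (0 < 3 ^ k)%N by rewrite expn_gt0.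
(* The predecessor compensates for [q.+1]; the quotient is positive because [n] is at least
   [3 ^ k]. *)
pose H := copies k (n %/ 3 ^ k).-1 (n %% 3 ^ k).
have cardH : #|H| = n.
  rewrite card_copies prednK -?divn_eq // divn_gt0 //.
  by apply: leq_trans n_ge; rewrite leq_pmull.
have PH : P #|edges H| by exists H; split=> //; exact: copies_saturated.
have [m Pm m_min] := ex_least PH.
exists m; split; first by split=> // G cG satG; apply: m_min; exists G.
split.
  have [G [cG satG Em]] := Pm.
  have := saturated_edges_ge satG; rewrite cG Em => le_m.
  rewrite lerBlDr ler_pdivrMr ?ltr0n // -!natrM -natrD -natrM ler_nat.
  lia.
have := copies_edges k (n %/ 3 ^ k).-1 (n %% 3 ^ k); rewrite -/H cardH.
have := m_min _ PH; have := ltn_pmod n pow_gt0.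
move: (3 ^ k)%N (n %% 3 ^ k)%N #|edges H| => M r e r_lt m_le e_le.
rewrite -natrM -natrD ler_nat.
have: ((M + r) * (M + r) <= (2 * M) * (2 * M))%N by apply: leq_mul; lia.
lia.
Qed.
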